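(* For any graphs $G$ and $H$, $$\gamma^{p}_{I}(G\,\square\, H)\le \min\{|V(H)|\,\gamma^{p}_{I}(G),\ |V(G)|\,\gamma^{p}_{I}(H)\}.$$
   Context: All graphs are finite and simple with nonempty vertex sets. A perfect Italian dominating function (PID-function) of a graph $G$ is a function $f:V(G)\to\{0,1,2\}$ such that for every vertex $v$ with $f(v)=0$ we have $\sum_{u\in N(v)}f(u)=2$, where $N(v)$ is the open neighborhood of $v$. Its weight is $\sum_{u\in V(G)}f(u)$. The perfect Italian domination number $\gamma^{p}_{I}(G)$ is the minimum weight of a PID-function of $G$. The Cartesian product $G\square H$ has vertex set $V(G)\times V(H)$, with $(u_1,v_1)$ adjacent to $(u_2,v_2)$ iff either $u_1=u_2$ and $v_1v_2\in E(H)$, or $v_1=v_2$ and $u_1u_2\in E(G)$. *)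

(* Defs.v *)
From mathcomp Require Import all_boot.

Set Implicit Arguments.
Unset Strict Implicit.
Unset Printing Implicit Defensive.

Record sgraph := SGraph {
  vertex :> finType;
  adj : rel vertex;
  adj_sym : symmetric adj;
  adj_irrefl : irreflexive adj;
  vertex_gt0 : 0 < #|vertex| }.

Definition open_nbhd (G : sgraph) (v : G) : {set G} := [set u | adj v u].

Section CartesianProduct.
Variables G H : sgraph.

Definition cart_adj : rel (G * H) := fun x y =>
  ((x.1 == y.1) && adj x.2 y.2) || ((x.2 == y.2) && adj x.1 y.1).

Lemma cart_adj_sym : symmetric cart_adj.
Proof.
move=> x y; rewrite /cart_adj [adj x.2 _]adj_sym [adj x.1 _]adj_sym.
by rewrite [x.1 == _]eq_sym [x.2 == _]eq_sym.
Qed.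

Lemma cart_adj_irrefl : irreflexive cart_adj.
Proof. by move=> x; rewrite /cart_adj !adj_irrefl !andbF. Qed.

Lemma cart_vertex_gt0 : 0 < #|{: G * H}|.
Proof. by rewrite card_prod muln_gt0 !vertex_gt0. Qed.

Definition cart_prod : sgraph :=
  SGraph cart_adj_sym cart_adj_irrefl cart_vertex_gt0.

End CartesianProduct.

Section PerfectItalianDomination.
Variable G : sgraph.
Implicit Type f : {ffun G -> 'I_3}.

Definition pid_function f : bool :=
  [forall v : G, (f v == 0 :> nat) ==> (\sum_(u in open_nbhd v) f u == 2)].

Definition weight f : nat := \sum_(u : G) f u.

(* The constant function 2 is a PID-function (pid_function_two), so the
   minimum below ranges over a nonempty set and is attained (pid_numberP). *)
Definition pid_number : nat :=
  weight [arg min_(f < [ffun=> ord_max] | pid_function f) weight f].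

Lemma pid_function_two : pid_function [ffun=> ord_max].
Proof. by apply/forallP=> v; rewrite ffunE. Qed.

Lemma pid_numberP :
  (exists2 f, pid_function f & weight f = pid_number) /\
  (forall f, pid_function f -> pid_number <= weight f).
Proof.
rewrite /pid_number; case: arg_minnP => [|f pid_f min_f].
  exact: pid_function_two.
by split=> //; exists f.
Qed.

End PerfectItalianDomination.

(* Main.v *)
Require Import Defs.
From mathcomp Require Import all_boot.

(** A PID-function [f] of one factor, made constant along the other factor, is a
    PID-function of the product: at a vertex of value 0 the neighbours in the
    direction of the other factor all have value 0, and the remaining ones are
    a copy of the neighbourhood in the first factor. *)

(** A step in the product moves exactly one coordinate, so the neighbourhood splits into a copy of
    each factor's neighbourhood. *)
Lemma sum_open_nbhd_cart (G H : sgraph) (x : cart_prod G H) (F : G * H -> nat) :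
  \sum_(y in open_nbhd x) F y
    = \sum_(u in open_nbhd x.1) F (u, x.2) + \sum_(v in open_nbhd x.2) F (x.1, v).
Proof.
case: x => a b /=.
have -> : open_nbhd ((a, b) : cart_prod G H)
    = [set (u, b) | u in open_nbhd a] :|: [set (a, v) | v in open_nbhd b].
  apply/setP=> -[u v]; rewrite !inE /= /cart_adj /= orbC.
  congr (_ || _); apply/andP/imsetP => [[/eqP<- adj_w] | [w]].
  - by exists u; rewrite ?inE.
  - by rewrite inE => adj_w [-> ->].
  - by exists v; rewrite ?inE.
  - by rewrite inE => adj_w [-> ->].
rewrite (eq_bigl _ _ (fun y => in_setU y _ _)) bigU /=; last first.
    (* A pair in both copies would have first coordinate [a], making [a] adjacent to itself. *)
    rewrite disjoint_subset; apply/subsetP=> -[u v] /imsetP[w].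
  rewrite inE => adj_aw [-> ->]; apply/imsetP=> -[w' _ [eq_wa _]].
  by rewrite eq_wa adj_irrefl in adj_aw.
(* Pairing with a fixed coordinate is injective, so each sum reindexes to its factor. *)
by congr (_ + _); apply: big_imset => ? ? _ _ [].
Qed.

Lemma pid_number_cart_fst (G H : sgraph) :
  pid_number (cart_prod G H) <= #|H| * pid_number G.
Proof.
have [[f /forallP pid_f <-] _] := pid_numberP G.
pose g : {ffun cart_prod G H -> 'I_3} := [ffun x => f x.1].
have -> : #|H| * weight f = weight g.
  rewrite /weight big_distrr /=; under [RHS]eq_bigr do rewrite ffunE.
  (* Each value [f u] is counted once per vertex of [H]. *)
  rewrite -(pair_bigA _ (fun u _ => f u : nat)) /=.
  by apply: eq_bigr => u _; rewrite sum_nat_const.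
apply: (pid_numberP _).2; apply/forallP=> x; apply/implyP.
rewrite ffunE => fx0; under eq_bigr do rewrite ffunE.
rewrite (sum_open_nbhd_cart _ _ _ (fun y => f y.1)) /=.
(* Along [H] every term is [f x.1], which is 0 by [fx0]; the sum along [G] is 2 by [pid_f]. *)
by rewrite [X in _ + X]big1 ?addn0 => [|v _]; [exact: implyP (pid_f _) fx0 | exact/eqP].
Qed.

Lemma pid_number_cart_snd (G H : sgraph) :
  pid_number (cart_prod G H) <= #|G| * pid_number H.
Proof.
have [[f /forallP pid_f <-] _] := pid_numberP H.
pose g : {ffun cart_prod G H -> 'I_3} := [ffun x => f x.2].
have -> : #|G| * weight f = weight g.
  rewrite /weight -sum_nat_const; under [RHS]eq_bigr do rewrite ffunE.
  by rewrite -(pair_bigA _ (fun _ v => f v : nat)).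
apply: (pid_numberP _).2; apply/forallP=> x; apply/implyP.
rewrite ffunE => fx0; under eq_bigr do rewrite ffunE.
rewrite (sum_open_nbhd_cart _ _ _ (fun y => f y.2)) /=.
(* Now the sum along [G] vanishes, its terms all being [f x.2]. *)
by rewrite big1 ?add0n => [|u _]; [exact: implyP (pid_f _) fx0 | exact/eqP].
Qed.

Theorem theorem4p1 (G H : sgraph) :
  pid_number (cart_prod G H)
    <= minn (#|H| * pid_number G) (#|G| * pid_number H).
Proof. by rewrite leq_min pid_number_cart_fst pid_number_cart_snd. Qed.
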